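(* Let $k\ge 2$ be an even integer, $\ell\ge1$ an integer and $0<\epsilon<1$. The sample complexity of $(k,\epsilon)$-uniformity testing using $\mathcal{W}_\ell$ for public-coin protocols is $\Omega\!\left(\frac{k}{2^{\ell/2}\epsilon^2}\right)$, i.e., at least $c\,\frac{k}{2^{\ell/2}\epsilon^2}$ for a universal constant $c>0$.
   Context: Notation: $[k]=\{1,\dots,k\}$; $\Delta_k$ is the set of probability distributions on $[k]$; $d_{TV}(\mathbf p,\mathbf q)=\frac12\sum_{x}|\mathbf p(x)-\mathbf q(x)|$; $\mathbf u$ is the uniform distribution on $[k]$. A channel $W$ from $[k]$ to a finite set $\mathcal Y$ is a stochastic matrix with entries $W(y\mid x)$. $\mathcal{W}_\ell$ is the family of all channels from $[k]$ to $\{0,1\}^\ell$. Distributed model: there are $n$ players; $X_1,\dots,X_n$ are i.i.d. from an unknown $\mathbf p\in\Delta_k$ and player $i$ holds $X_i$. Player $i$ selects a channel $W_i\in\mathcal W$ and sends to a referee the output $Y_i$ of $W_i$ on input $X_i$ (the randomness realizing channel outputs is independent across players and unseen by the referee). In a public-coin protocol, a random variable $U$ independent of $X^n$ is available to all players and the referee, each $W_i$ is a function of $U$, and the referee's output may depend on $(Y^n,U)$. In a private-coin protocol, $U_1,\dots,U_n$ are mutually independent and independent of $X^n$, $W_i$ is a function of $U_i$ only, and the referee sees only $Y^n$. An $(n,\epsilon)$-test for identity to a reference $\mathbf q\in\Delta_k$ using $\mathcal W$ consists of such a protocol and a referee mapping $T$ with values in $\{0,1\}$ such that $\Pr[T=1]>11/12$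 when $\mathbf p=\mathbf q$ and $\Pr[T=0]>11/12$ whenever $d_{TV}(\mathbf p,\mathbf q)>\epsilon$. $(k,\epsilon)$-uniformity testing is this problem with $\mathbf q=\mathbf u$; its sample complexity using $\mathcal W$ for public-coin (resp. private-coin) protocols is the least $n$ for which such a test with a public-coin (resp. private-coin) protocol exists.
   Formalization: The bound with one universal c for all 0<ε<1 fails (for ε≥1−1/k one player suffices), so it is proved for 0<ε≤ε₀ with any fixed ε₀<1 and c>0 depending only on ε₀; the sample complexity is the least n≥1. *)

(* Defs.v *)
From HB Require Import structures.
From mathcomp Require Import all_boot all_order all_algebra.
From mathcomp Require Import all_classical all_reals all_analysis.

Set Implicit Arguments.
Unset Strict Implicit.
Unset Printing Implicit Defensive.
Import Order.TTheory GRing.Theory Num.Theory.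
Local Open Scope classical_set_scope.
Local Open Scope ring_scope.

Section finite_distributions.
Variable R : realType.

Definition prob_simplex (A : finType) : set (A -> R) :=
  [set p | (forall a, 0 <= p a) /\ \sum_a p a = 1].

Definition unif_dist (A : finType) : A -> R := fun=> #|A|%:R^-1.

Definition dTV (A : finType) (p q : A -> R) : R :=
  2^-1 * \sum_a `|p a - q a|.

(* [W x y] stands for W(y | x). *)
Definition channels (A B : finType) : set (A -> B -> R) :=
  [set W | forall x, prob_simplex (W x)].

Definition bit_channels (k ell : nat) : set ('I_k -> ell.-tuple bool -> R) :=
  @channels 'I_k (ell.-tuple bool).

End finite_distributions.

Arguments unif_dist R A : clear implicits.
Arguments bit_channels R k ell : clear implicits.

Section testing.
Variables (R : realType) (A B : finType).

(* Conditional law of (X^n, Y^n) given the public coins: the X_i are i.i.d.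
   from p, and Y_i is the output of the i-th channel on input X_i, the channels
   having independent internal randomness. *)
Definition joint_pmf (n : nat) (p : A -> R) (W : 'I_n -> A -> B -> R)
    (x : {ffun 'I_n -> A}) (y : {ffun 'I_n -> B}) : R :=
  \prod_(i < n) (p (x i) * W i (x i) (y i)).

(* The public coins U are the identity on an arbitrary probability space. *)
Record public_coin_protocol (F : set (A -> B -> R)) (n : nat) := PublicCoin {
  coin_display : measure_display;
  coin : measurableType coin_display;
  coin_law : probability coin R;
  chan : coin -> 'I_n -> A -> B -> R;
  chan_family : forall u i, F (chan u i);
  chan_measurable : forall i x y,
    measurable_fun [set: coin] (fun u => chan u i x y) }.

Definition referee (F : set (A -> B -> R)) (n : nat)
    (pi : public_coin_protocol F n) :=
  {T : {ffun 'I_n -> B} -> coin pi -> bool |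
     forall y, measurable_fun [set: coin pi] (T y)}.

(* Pr[T(Y^n, U) = b] when the samples are drawn from p; U is independent of
   X^n. *)
Definition referee_prob (F : set (A -> B -> R)) (n : nat)
    (pi : public_coin_protocol F n) (T : referee pi) (p : A -> R) (b : bool)
    : \bar R :=
  \int[coin_law pi]_(u in [set: coin pi])
    (\sum_(x : {ffun 'I_n -> A}) \sum_(y : {ffun 'I_n -> B} | sval T y u == b)
       joint_pmf p (chan u) x y)%:E.

Definition identity_test (q : A -> R) (eps : R) (F : set (A -> B -> R))
    (n : nat) (pi : public_coin_protocol F n) (T : referee pi) : Prop :=
  ((11 / 12)%:E < referee_prob T q true)%E /\
  forall p, prob_simplex p -> eps < dTV p q ->
    ((11 / 12)%:E < referee_prob T p false)%E.

(* The least number n >= 1 of players for which a public-coin (n, eps)-test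
   exists; it is +oo if there is none. *)
Definition uniformity_sample_complexity (eps : R) (F : set (A -> B -> R))
    : \bar R :=
  ereal_inf [set (n%:R)%:E | n in [set n : nat | (0 < n)%N /\
    exists (pi : public_coin_protocol F n) (T : referee pi),
      identity_test (unif_dist R A) eps T]].

End testing.

(* Main.v *)
Require Import Defs.
From HB Require Import structures.
From mathcomp Require Import all_boot all_order all_algebra.
From mathcomp Require Import all_classical all_reals all_analysis.
From mathcomp Require Import measurable_realfun ring lra.
Import Order.TTheory GRing.Theory Num.Theory.
Local Open Scope classical_set_scope.
Local Open Scope ring_scope.

(* Split (most of) the domain into blocks of m symbols and let p_z, for z picking
   one symbol per block, tilt the uniform law u by 1 + d psi_z, where psi_z is
   m - 1 at the picked symbols and -1 elsewhere in the blocks.  A test succeeds,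
   for each value of the coins, only if the mixture over z of the laws of Y^n is
   far from the law under u.  Its chi-square distance (plus one) is
     E_(z, z') prod_i (1 + <psi_z, M_i psi_z'>) <= E_(z, z') exp <psi_z, M psi_z'>
   with M_i x x' = (d^2 / k) sum_y W_i(y|x) W_i(y|x') / sum_a W_i(y|a) and
   M = sum_i M_i.  Averaging over z first gives exp (C |M psi_z'|^2), whose mean is
   O(1) as soon as the squared Frobenius norm of M is small; that norm is at most
   d^4 n^2 2^ell / k^2.  Blocks of two symbols give distances up to 1/2; distances
   up to eps0 < 1 need longer blocks. *)

Set Implicit Arguments.
Unset Strict Implicit.
Unset Printing Implicit Defensive.

(** * Exponential moments over product spaces *)

Lemma ler_of_eq (R : numDomainType) (x y : R) : x = y -> x <= y.
Proof. by move=> ->. Qed.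

Section moments.
Variable R : realType.

(** In a mean-zero sum the linear term cancels, which leaves a sub-Gaussian bound. Between [-1/2]
    and [1/2] the reason is [expR x <= 1 / (1 - x) <= 1 + x + 2 x^2]; beyond, [x <= 2 x^2] or
    [expR x <= 1] suffices. *)
Lemma expR_le_add_expR_sqr (x : R) : expR x <= x + expR (2 * x ^+ 2).
Proof.
have h2 := expR_ge1Dx (2 * x ^+ 2).
have [hx|hx] := leP 2^-1 x.
  have : expR x <= expR (2 * x ^+ 2) by rewrite ler_expR; nra.
  lra.
have [hx'|hx'] := leP x (- 2^-1).
  have : expR x <= expR 0 by rewrite ler_expR; lra.
  rewrite expR0; nra.
have h : expR x <= (1 - x)^-1.
  rewrite -[x in expR x]opprK expRN lef_pV2 ?posrE ?expR_gt0 //; last lra.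
  exact: expR_ge1Dx.
have : (1 - x)^-1 <= 1 + x + 2 * x ^+ 2.
  have h1 : 0 < 1 - x by lra.
  rewrite -(ler_pM2r h1) mulVf ?gt_eqF //; nra.
lra.
Qed.

Lemma sum_sqr_le_CauchySchwarz (T : finType) (a b : T -> R) :
  (\sum_i a i * b i) ^+ 2 <= (\sum_i a i ^+ 2) * (\sum_i b i ^+ 2).
Proof.
(* Lagrange's identity: this double sum is twice the defect in the Cauchy-Schwarz inequality. *)
have : 0 <= \sum_i \sum_j (a i * b j - a j * b i) ^+ 2.
  by apply: sumr_ge0 => i _; apply: sumr_ge0 => j _; exact: sqr_ge0.
have -> : \sum_i \sum_j (a i * b j - a j * b i) ^+ 2 =
    \sum_i \sum_j a i ^+ 2 * b j ^+ 2 + \sum_i \sum_j b i ^+ 2 * a j ^+ 2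
    - 2 * \sum_i \sum_j (a i * b i) * (a j * b j).
  rewrite mulr_sumr -big_split -sumrB; apply: eq_bigr => i _.
  rewrite mulr_sumr -big_split -sumrB; apply: eq_bigr => j _ /=; ring.
have h (f g : T -> R) : \sum_i \sum_j f i * g j = (\sum_i f i) * (\sum_j g j).
  by rewrite mulr_suml; apply: eq_bigr => i _; rewrite mulr_sumr.
rewrite !h; lra.
Qed.

Lemma sum_expR_mean0 (J : finType) (g : J -> R) (s : R) :
  \sum_j g j = 0 -> (forall j, g j ^+ 2 <= s) ->
  \sum_j expR (g j) <= #|J|%:R * expR (2 * s).
Proof.
move=> g0 gs; apply: (@le_trans _ _ (\sum_j (g j + expR (2 * s)))).
  apply: ler_sum => j _; apply: le_trans (expR_le_add_expR_sqr _) _.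
  by rewrite lerD2l ler_expR ler_pM2l.
by rewrite big_split /= g0 add0r sumr_const -[leLHS]mulr_natl.
Qed.

(** The exponential of a sum over coordinates is a product, so the sum over [z] factors into one
    mean-zero sum per coordinate. *)
Lemma sum_ffun_expR_linear (I J : finType) (g : I -> J -> R) (s : I -> R) :
  (forall b, \sum_j g b j = 0) -> (forall b j, g b j ^+ 2 <= s b) ->
  \sum_(z : {ffun I -> J}) expR (\sum_b g b (z b)) <=
    #|{ffun I -> J}|%:R * expR (2 * \sum_b s b).
Proof.
move=> g0 gs.
under eq_bigr do rewrite expR_sum.
rewrite -(bigA_distr_bigA (fun b j => expR (g b j))).
have -> : #|{ffun I -> J}|%:R * expR (2 * \sum_b s b) =
    \prod_b (#|J|%:R * expR (2 * s b)).
  by rewrite mulr_sumr expR_sum big_split /= prodr_const card_ffun natrX.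
apply: ler_prod => b _; apply/andP; split; last exact: sum_expR_mean0.
by apply: sumr_ge0 => j _; exact: expR_ge0.
Qed.

Definition upd (I J : finType) (z : {ffun I -> J}) (b : I) (j : J) :=
  [ffun i => if i == b then j else z i].

(** Resampling one coordinate preserves the uniform measure: exchanging [j] with [z b] is an
    involution on pairs. *)
Lemma sum_ffun_upd (I J : finType) (F : {ffun I -> J} -> R) (b : I) :
  \sum_z \sum_j F (upd z b j) = #|J|%:R * \sum_z F z.
Proof.
rewrite pair_bigA /=.
pose h (p : {ffun I -> J} * J) := (upd p.1 b p.2, p.1 b).
have hK : involutive h.
  move=> [z j]; rewrite /h /upd /= !ffunE eqxx; congr pair.
  by apply/ffunP => i; rewrite !ffunE; case: eqP => [->|].
rewrite (reindex_inj (inv_inj hK)) /=.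
transitivity (\sum_(p : {ffun I -> J} * J) F p.1).
  by apply: eq_bigr => p _; congr F; have /(congr1 fst) := hK p.
rewrite -(pair_bigA _ (fun z (j : J) => F z)) /= mulr_sumr.
by apply: eq_bigr => z _; rewrite sumr_const mulr_natl.
Qed.

(** Here [t] stands for the coordinates held fixed while one coordinate is averaged. Expanding the
    square leaves a cross term with mean zero in [j] and, by Cauchy-Schwarz, square at most
    [4 lam^2 s] times the squared norm of [t]; its exponential moment produces the term
    [8 lam^2 s]. *)
Lemma sum_expR_sqr_shift (J X : finType) (g : J -> X -> R) (t : X -> R) (s lam : R) :
  0 <= lam -> (forall x, \sum_j g j x = 0) ->
  (forall j, \sum_x g j x ^+ 2 <= s) ->
  \sum_j expR (lam * \sum_x (g j x + t x) ^+ 2) <=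
    #|J|%:R * expR ((lam + 8 * lam ^+ 2 * s) * (\sum_x t x ^+ 2) + lam * s).
Proof.
move=> lam0 g0 gs; set tt := \sum_x t x ^+ 2.
have tt0 : 0 <= tt by apply: sumr_ge0 => x _; exact: sqr_ge0.
pose f j := 2 * lam * \sum_x t x * g j x.
have E j : lam * \sum_x (g j x + t x) ^+ 2 =
    lam * \sum_x g j x ^+ 2 + f j + lam * tt.
  rewrite /f /tt !mulr_sumr -!big_split; apply: eq_bigr => x _ /=; ring.
apply: (@le_trans _ _ (\sum_j expR (lam * s + lam * tt) * expR (f j))).
  apply: ler_sum => j _; rewrite E -expRD ler_expR.
  by have := ler_wpM2l lam0 (gs j); lra.
rewrite -mulr_sumr.
have fs j : f j ^+ 2 <= 4 * lam ^+ 2 * (tt * s).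
  rewrite /f exprMn.
  have h : (\sum_x t x * g j x) ^+ 2 <= tt * s.
    by apply: le_trans (sum_sqr_le_CauchySchwarz _ _) _; rewrite ler_wpM2l.
  have := ler_wpM2l (sqr_ge0 (2 * lam)) h; lra.
have f0 : \sum_j f j = 0.
  rewrite -mulr_sumr exchange_big /= big1 ?mulr0 // => x _.
  by rewrite -mulr_sumr g0 mulr0.
have := ler_wpM2l (expR_ge0 (lam * s + lam * tt)) (sum_expR_mean0 f0 fs).
rewrite mulrCA -expRD => /le_trans; apply.
by rewrite ler_wpM2l // ler_expR; lra.
Qed.

(* Averaging over one coordinate [z b] turns [lam] into [lam + 8 * lam ^+ 2 * s b];
   [mu] bounds all the successive values of [lam]. *)
Lemma sum_ffun_expR_sqr_seq (I J X : finType) (g : I -> J -> X -> R) (s : I -> R)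
    (r : seq I) (lam mu : R) :
  (0 < #|J|)%N -> (forall b x, \sum_j g b j x = 0) ->
  (forall b j, \sum_x g b j x ^+ 2 <= s b) -> (forall b, 0 <= s b) -> uniq r ->
  0 <= lam -> lam + 8 * mu ^+ 2 * (\sum_(b <- r) s b) <= mu ->
  \sum_(z : {ffun I -> J}) expR (lam * \sum_x (\sum_(b <- r) g b (z b) x) ^+ 2) <=
    #|{ffun I -> J}|%:R * expR (mu * \sum_(b <- r) s b).
Proof.
move=> J0 g0 gs s0; elim: r lam => [|b r IH] lam /= .
  move=> _ _ _; rewrite big_nil mulr0 expR0 mulr1.
  under eq_bigr do (under eq_bigr do rewrite big_nil expr0n /=;
    rewrite big1 // mulr0 expR0).
  by rewrite sumr_const.
move=> /andP[br ur] lam0; rewrite big_cons => hmu.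
have S0 : 0 <= \sum_(b <- r) s b by exact: sumr_ge0.
have J0' : 0 < #|J|%:R :> R by rewrite ltr0n.
have lmu : lam <= mu by have := s0 b; nra.
rewrite -(ler_pM2l J0') -(@sum_ffun_upd _ _ _ b).
pose lam' := lam + 8 * lam ^+ 2 * s b.
apply: (@le_trans _ _ (\sum_(z : {ffun I -> J}) #|J|%:R *
    (expR (lam' * \sum_x (\sum_(b <- r) g b (z b) x) ^+ 2) * expR (lam * s b)))).
  apply: ler_sum => z _; rewrite -expRD.
  have h := sum_expR_sqr_shift (fun x => \sum_(b <- r) g b (z b) x) lam0 (g0 b)
    (gs b).
  apply: le_trans h.
  apply: ler_of_eq; apply: eq_bigr => j _.
  congr (expR (_ * _)); apply: eq_bigr => x _.
  rewrite big_cons /upd ffunE eqxx; congr ((_ + _) ^+ 2).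
  rewrite !big_seq; apply: eq_bigr => c cr; rewrite ffunE.
  by case: eqP => // cb; rewrite cb (negPf br) in cr.
rewrite -mulr_sumr ler_pM2l //.
rewrite -mulr_suml.
have h1 : 0 <= lam' by have := s0 b; rewrite /lam'; nra.
(* As [lam <= mu], the growth [8 lam^2 s b] is at most the share of [b] in the budget [hmu], so the
   induction hypothesis applies to [lam']. *)
have h2 : lam ^+ 2 <= mu ^+ 2 by rewrite ler_sqr ?nnegrE //; lra.
have h3 : lam' + 8 * mu ^+ 2 * (\sum_(b <- r) s b) <= mu.
  by have := ler_wpM2r (s0 b) h2; rewrite /lam'; lra.
apply: (le_trans (ler_wpM2r (expR_ge0 _) (IH _ ur h1 h3))).
rewrite -mulrA -expRD ler_wpM2l // ler_expR.
by have := ler_wpM2r (s0 b) lmu; lra.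
Qed.

Lemma sum_ffun_expR_sqr (I J X : finType) (g : I -> J -> X -> R) (s : I -> R)
    (lam : R) :
  (0 < #|J|)%N -> (forall b x, \sum_j g b j x = 0) ->
  (forall b j, \sum_x g b j x ^+ 2 <= s b) -> (forall b, 0 <= s b) ->
  0 <= lam -> 32 * lam * (\sum_b s b) <= 1 ->
  \sum_(z : {ffun I -> J}) expR (lam * \sum_x (\sum_b g b (z b) x) ^+ 2) <=
    #|{ffun I -> J}|%:R * expR (2 * lam * \sum_b s b).
Proof.
move=> J0 g0 gs s0 lam0 h.
(* With [mu := 2 * lam], the condition on [mu] is the last hypothesis multiplied by [lam]. *)
apply: sum_ffun_expR_sqr_seq => //; first exact: index_enum_uniq.
by have := ler_wpM2l lam0 h; lra.
Qed.

End moments.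

(** * Block perturbations *)

Lemma ler_sum_inj (R : numDomainType) (T U : finType) (e : T -> U) (f : U -> R) :
  injective e -> (forall u, 0 <= f u) -> \sum_t f (e t) <= \sum_u f u.
Proof.
move=> e_inj f0.
have <- : \sum_(u in e @: [set: T]%SET) f u = \sum_t f (e t).
  by rewrite big_imset /=; [apply: eq_bigl => t; rewrite inE|move=> ? ? _ _ /e_inj].
rewrite [leLHS]big_mkcond; apply: ler_sum => u _.
by case: ifP.
Qed.

Lemma sum_delta (R : pzSemiRingType) (T : finType) (a : T) (f : T -> R) :
  \sum_x (x == a)%:R * f x = f a.
Proof.
rewrite (bigD1 a) //= eqxx mul1r big1 ?addr0 // => x /negPf ->.
by rewrite mul0r.
Qed.

Lemma sum_pair (V : nmodType) (I J : finType) (F : I * J -> V) :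
  \sum_p F p = \sum_b \sum_j F (b, j).
Proof. by rewrite pair_bigA; apply: eq_bigr => -[]. Qed.

Section perturbation.
Variables (R : realType) (A I J : finType) (e : I * J -> A).
Hypothesis e_inj : injective e.
Hypothesis J_gt0 : (0 < #|J|)%N.

Let m : R := #|J|%:R.

Definition block_coef (z : {ffun I -> J}) (p : I * J) : R :=
  m * (p.2 == z p.1)%:R - 1.

(** Summing indicators extends the block coefficients by zero outside the range of [e], without an
    inverse of [e]. *)
Definition perturb (z : {ffun I -> J}) (x : A) : R :=
  \sum_p (x == e p)%:R * block_coef z p.

(** The share of block [b] in the inner product of [v] with a perturbation that picks [j] in this
    block. *)
Definition block_pair (v : A -> R) (b : I) (j : J) : R :=
  m * v (e (b, j)) - \sum_j' v (e (b, j')).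

Lemma sum_mul_perturb (v : A -> R) (z : {ffun I -> J}) :
  \sum_x v x * perturb z x = \sum_b block_pair v b (z b).
Proof.
transitivity (\sum_p v (e p) * block_coef z p).
  under eq_bigr do rewrite mulr_sumr.
  rewrite exchange_big; apply: eq_bigr => p _.
  rewrite -[RHS](sum_delta (e p) (fun x => v x * block_coef z p)).
  by apply: eq_bigr => x _; rewrite mulrCA.
rewrite sum_pair; apply: eq_bigr => b _; rewrite /block_pair /block_coef /=.
rewrite -(sum_delta (z b) (fun j => v (e (b, j)))) mulr_sumr -sumrB.
by apply: eq_bigr => j _; ring.
Qed.

Lemma sum_block_pair (v : A -> R) b : \sum_j block_pair v b j = 0.
Proof. by rewrite sumrB -mulr_sumr sumr_const -[X in _ - X]mulr_natl subrr. Qed.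

(** Cauchy-Schwarz against the coefficients of one block, whose squared norm is
    [(m - 1)^2 + (m - 1) = m^2 - m]. *)
Lemma block_pair_sqr_le (v : A -> R) b j :
  block_pair v b j ^+ 2 <= m ^+ 2 * \sum_j' v (e (b, j')) ^+ 2.
Proof.
have -> : block_pair v b j = \sum_j' (m * (j' == j)%:R - 1) * v (e (b, j')).
  rewrite /block_pair -(sum_delta j (fun j => v (e (b, j)))) mulr_sumr -sumrB.
  by apply: eq_bigr => j' _; ring.
apply: (le_trans (sum_sqr_le_CauchySchwarz _ _)).
apply: ler_wpM2r; first by apply: sumr_ge0 => ? _; exact: sqr_ge0.
have -> : \sum_i (m * (i == j)%:R - 1) ^+ 2 =
    \sum_i ((i == j)%:R * (m ^+ 2 - 2 * m) + 1).
  by apply: eq_bigr => i _; case: (i == j) => /=; ring.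
rewrite big_split /= (sum_delta j (fun=> _)) sumr_const -/m.
by have : 1 <= m; [rewrite ler1n|nra].
Qed.

Lemma sum_block_sqr_le (v : A -> R) :
  \sum_b \sum_j v (e (b, j)) ^+ 2 <= \sum_x v x ^+ 2.
Proof.
rewrite -(sum_pair (fun p => v (e p) ^+ 2)).
exact: (ler_sum_inj e_inj (fun x => sqr_ge0 (v x))).
Qed.

Lemma sum_perturb z : \sum_x perturb z x = 0.
Proof.
transitivity (\sum_x 1 * perturb z x); first by under [RHS]eq_bigr do rewrite mul1r.
rewrite (sum_mul_perturb (fun=> 1)) big1 // => b _.
by rewrite /block_pair mulr1 sumr_const subrr.
Qed.

Lemma perturb_inj z p : perturb z (e p) = block_coef z p.
Proof.
rewrite -(sum_delta p (block_coef z)); apply: eq_bigr => q _.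
by rewrite (inj_eq e_inj) eq_sym.
Qed.

Lemma perturb_geN1 z x : -1 <= perturb z x.
Proof.
have [/codomP[p ->]|xNe] := boolP (x \in codom e).
  rewrite perturb_inj /block_coef -[leLHS]add0r lerD2r.
  by rewrite mulr_ge0 ?ler0n.
rewrite /perturb big1 ?lerN10 // => p _.
case: eqP => [xe|]; last by rewrite mul0r.
by rewrite xe codom_f in xNe.
Qed.

Lemma sum_norm_perturb_ge z : #|I|%:R * (2 * (m - 1)) <= \sum_x `|perturb z x|.
Proof.
have m1 : 1 <= m by rewrite ler1n.
apply: le_trans (ler_sum_inj e_inj (fun x => normr_ge0 (perturb z x))).
under eq_bigr do rewrite perturb_inj.
rewrite sum_pair mulr_natl -sumr_const; apply: ler_sum => b _.
(* The picked symbol counts [m - 1] and each other symbol of the block counts [1], so a block has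
   norm [2 (m - 1)]. *)
have -> : \sum_j `|m * (j == z b)%:R - 1| =
    \sum_j ((j == z b)%:R * (m - 2) + 1).
  apply: eq_bigr => j _; case: (j == z b); rewrite ?mulr1 ?mulr0 ?mul1r ?mul0r.
    by rewrite ger0_norm; lra.
  by rewrite sub0r normrN1 add0r.
rewrite big_split /= (sum_delta (z b) (fun=> _)) sumr_const -/m; lra.
Qed.

(** For fixed [z'] the exponent is linear in [z]; averaging over [z] leaves the exponential of
    [2 m^2] times the squared norm of [v z']. The quadratic bound then applies with [lam = 2 m^2]
    and [sum s <= m^2 T]: its smallness condition becomes [64 m^4 T <= 1], and the final exponent is
    at most [4 m^4 T <= 1/16]. *)
Lemma sum_expR_perturb_bilinear (M : A -> A -> R) :
  64 * m ^+ 4 * (\sum_x \sum_x' M x x' ^+ 2) <= 1 ->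
  \sum_z \sum_z' expR (\sum_x \sum_x' perturb z x * perturb z' x' * M x x') <=
  #|{ffun I -> J}|%:R ^+ 2 * expR 16^-1.
Proof.
set T := \sum_x _ => hT.
have m1 : 1 <= m by rewrite ler1n.
have m2 : 0 <= m ^+ 2 by exact: sqr_ge0.
pose N : R := #|{ffun I -> J}|%:R.
pose g b j x := block_pair (M x) b j.
pose v (z' : {ffun I -> J}) x := \sum_b g b (z' b) x.
pose s b := m ^+ 2 * \sum_x \sum_j M x (e (b, j)) ^+ 2.
have sT : \sum_b s b <= m ^+ 2 * T.
  rewrite -mulr_sumr; apply: ler_wpM2l => //.
  by rewrite exchange_big; apply: ler_sum => x _; exact: sum_block_sqr_le.
have inner z' : \sum_z expR (\sum_x \sum_x' perturb z x * perturb z' x' * M x x')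
    <= N * expR (2 * m ^+ 2 * \sum_x v z' x ^+ 2).
  have E z : \sum_x \sum_x' perturb z x * perturb z' x' * M x x' =
      \sum_b block_pair (v z') b (z b).
    rewrite -sum_mul_perturb; apply: eq_bigr => x _.
    rewrite /v /g -sum_mul_perturb mulr_suml.
    by apply: eq_bigr => x' _; ring.
  under eq_bigr do rewrite E.
  apply: (le_trans (sum_ffun_expR_linear (sum_block_pair _) (block_pair_sqr_le _))).
  apply: ler_wpM2l; first exact: ler0n.
  rewrite ler_expR -mulr_sumr -mulrA ler_pM2l // ler_wpM2l //.
  exact: sum_block_sqr_le.
rewrite exchange_big; apply: (le_trans (ler_sum _ (fun z' _ => inner z'))).
rewrite -mulr_sumr expr2 -mulrA ler_wpM2l ?ler0n //.
have s0 b : 0 <= s b.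
  apply: mulr_ge0 => //.
  by apply: sumr_ge0 => x _; apply: sumr_ge0 => j _; exact: sqr_ge0.
apply: (le_trans (sum_ffun_expR_sqr (s := s) _ _ _ _ _ _)) => //.
- by move=> b x; exact: sum_block_pair.
- move=> b j; rewrite /s mulr_sumr; apply: ler_sum => x _.
  exact: block_pair_sqr_le.
- lra.
- by have := ler_wpM2l m2 sT; lra.
- apply: ler_wpM2l; first exact: ler0n.
  by rewrite ler_expR; have := ler_wpM2l m2 sT; lra.
Qed.

End perturbation.

(** * Perturbed inputs seen through channels *)

Section channel.
Variables (R : realType) (A Y : finType).

Definition output (p : A -> R) (W : A -> Y -> R) (y : Y) : R :=
  \sum_x p x * W x y.

(** Up to scaling, the kernel of the chi-square form of the channel. A message that no symbol
    produces contributes [0], since division by zero gives [0]. *)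
Definition overlap (W : A -> Y -> R) (x x' : A) : R :=
  \sum_y W x y * W x' y / \sum_a W a y.

Definition tilt (d : R) (psi : A -> R) (x : A) : R :=
  #|A|%:R^-1 * (1 + d * psi x).

Lemma sum_output (p : A -> R) (W : A -> Y -> R) :
  channels W -> \sum_y output p W y = \sum_x p x.
Proof.
move=> hW; rewrite exchange_big; apply: eq_bigr => x _.
by rewrite -mulr_sumr (hW x).2 mulr1.
Qed.

Lemma output_ge0 (p : A -> R) (W : A -> Y -> R) y :
  channels W -> (forall x, 0 <= p x) -> 0 <= output p W y.
Proof.
by move=> hW p0; apply: sumr_ge0 => x _; rewrite mulr_ge0 // (hW x).1.
Qed.

(** Jensen's inequality for the law [W x] moves the square inside the sum over [y]. Summing over [x]
    then leaves, for each message [y], the sum over [x'] of [W x' y ^ 2 / S y], which is at most [1]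
    because entries of [W] are at most [1]. *)
Lemma overlap_frobenius (W : A -> Y -> R) : channels W ->
  \sum_x \sum_x' overlap W x x' ^+ 2 <= #|Y|%:R.
Proof.
move=> hW; have W0 x y : 0 <= W x y by exact: (hW x).1.
pose S y := \sum_a W a y.
have jensen x x' : overlap W x x' ^+ 2 <= \sum_y W x y * (W x' y / S y) ^+ 2.
  set mu := overlap W x x'; have Emu : mu = \sum_y W x y * W x' y / S y by [].
  clearbody mu.
  have : 0 <= \sum_y W x y * (W x' y / S y - mu) ^+ 2.
    by apply: sumr_ge0 => y _; rewrite mulr_ge0 ?sqr_ge0.
  have -> : \sum_y W x y * (W x' y / S y - mu) ^+ 2 =
      \sum_y W x y * (W x' y / S y) ^+ 2 - 2 * mu * (\sum_y W x y * W x' y / S y)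
      + mu ^+ 2 * \sum_y W x y.
    rewrite !mulr_sumr -sumrB -big_split.
    by apply: eq_bigr => y _ /=; ring.
  by rewrite -Emu (hW x).2; lra.
apply: (@le_trans _ _ (\sum_x \sum_x' \sum_y W x y * (W x' y / S y) ^+ 2)).
  by apply: ler_sum => x _; apply: ler_sum => x' _; exact: jensen.
under eq_bigr do rewrite exchange_big.
rewrite exchange_big /= -sumr_const; apply: ler_sum => y _.
under eq_bigr do rewrite -mulr_sumr.
rewrite -mulr_suml -/(S y).
have [->|Sy] := eqVneq (S y) 0; first by rewrite mul0r ler01.
have Sy0 : 0 < S y by rewrite lt_neqAle eq_sym Sy; apply: sumr_ge0.
rewrite mulr_sumr; apply: (@le_trans _ _ (\sum_x W x y / S y)); last first.
  by rewrite -mulr_suml -/(S y) mulfV.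
apply: ler_sum => x _.
have -> : S y * (W x y / S y) ^+ 2 = W x y * (W x y / S y) by field.
rewrite ler_wpM2l // ler_piMl ?invr_ge0 ?(ltW Sy0) // -(hW x).2.
by rewrite (bigD1 y) //= lerDl; exact: sumr_ge0.
Qed.

Lemma output_tilt d psi W y : output (tilt d psi) W y =
  #|A|%:R^-1 * (\sum_x W x y + d * \sum_x psi x * W x y).
Proof.
rewrite mulrDr !mulr_sumr -big_split; apply: eq_bigr => x _ /=.
by rewrite /tilt; ring.
Qed.

Lemma output_unif W y :
  output (unif_dist R A) W y = #|A|%:R^-1 * \sum_x W x y.
Proof. by rewrite mulr_sumr. Qed.

(** Absolute continuity with respect to the uniform input, so that chi-square quotients with zero
    denominator lose no mass. *)
Lemma output_tilt_eq0 d psi W y : channels W -> (0 < #|A|)%N ->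
  output (unif_dist R A) W y = 0 -> output (tilt d psi) W y = 0.
Proof.
move=> hW A0; have A0' : #|A|%:R^-1 != 0 :> R by rewrite invr_eq0 pnatr_eq0 -lt0n.
rewrite output_unif => /eqP; rewrite mulf_eq0 (negPf A0') /=.
rewrite psumr_eq0 => [/allP h|x _]; last exact: (hW x).1.
rewrite /output big1 // => x _.
by have /eqP -> := h x (mem_index_enum _); rewrite mulr0.
Qed.

(** Rows of [W] sum to [1], so the terms linear in [psi] or [psi'] sum to zero over the messages and
    only the bilinear term survives. *)
Lemma sum_output_tilt_chi2 d psi psi' W : channels W -> (0 < #|A|)%N ->
  \sum_x psi x = 0 -> \sum_x psi' x = 0 ->
  \sum_y output (tilt d psi) W y * output (tilt d psi') W y
    / output (unif_dist R A) W y =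
  1 + \sum_x \sum_x' psi x * psi' x' * (d ^+ 2 / #|A|%:R * overlap W x x').
Proof.
move=> hW A0 s0 s0'.
have k0 : #|A|%:R != 0 :> R by rewrite pnatr_eq0 -lt0n.
pose S y := \sum_x W x y.
pose D (f : A -> R) y := \sum_x f x * W x y.
have E y : output (tilt d psi) W y * output (tilt d psi') W y
    / output (unif_dist R A) W y =
    #|A|%:R^-1 * (S y + d * D psi y + d * D psi' y +
      d ^+ 2 * (D psi y * D psi' y / S y)).
  have [S0|S0] := eqVneq (S y) 0.
    have W0 x : W x y = 0.
      have /eqP := S0; rewrite psumr_eq0 => [/allP h|a _]; last exact: (hW a).1.
      by have /eqP := h x (mem_index_enum _).
    have D0 f : D f y = 0 by rewrite /D big1 // => x _; rewrite W0 mulr0.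
    rewrite output_unif -/(S y) S0 !D0 mulr0 !invr0; ring.
  rewrite !output_tilt output_unif -/(S y) -/(D _ y) -/(D psi' y).
  by field; rewrite S0 k0.
under eq_bigr do rewrite E.
rewrite -mulr_sumr !big_split /= -!mulr_sumr.
have sD f : \sum_y D f y = \sum_x f x by exact: sum_output.
have sS : \sum_y S y = #|A|%:R.
  rewrite exchange_big -sumr_const; apply: eq_bigr => x _; exact: (hW x).2.
rewrite !sD s0 s0' sS !mulr0 !addr0 mulrDr mulVf //; congr (_ + _).
have -> : \sum_y D psi y * D psi' y / S y =
    \sum_x \sum_x' psi x * psi' x' * overlap W x x'.
  under [RHS]eq_bigr do (under eq_bigr do rewrite mulr_sumr; rewrite exchange_big).
  rewrite exchange_big; apply: eq_bigr => y _ /=.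
  rewrite -mulrA mulr_suml; apply: eq_bigr => x _.
  rewrite mulr_suml mulr_sumr; apply: eq_bigr => x' _.
  by rewrite -/(S y); ring.
rewrite !mulr_sumr; apply: eq_bigr => x _; rewrite !mulr_sumr.
by apply: eq_bigr => x' _; ring.
Qed.

Definition output_seq (n : nat) (W : 'I_n -> A -> Y -> R) (p : A -> R)
    (y : {ffun 'I_n -> Y}) : R := \prod_i output p (W i) (y i).

Lemma sum_joint_pmf n (W : 'I_n -> A -> Y -> R) (p : A -> R) y :
  \sum_(x : {ffun 'I_n -> A}) joint_pmf p W x y = output_seq W p y.
Proof. by rewrite /output_seq bigA_distr_bigA. Qed.

Section players.
Variables (n : nat) (W : 'I_n -> A -> Y -> R).
Hypothesis hW : forall i, channels (W i).
Hypothesis A_gt0 : (0 < #|A|)%N.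

Lemma output_seq_ge0 p y : (forall x, 0 <= p x) -> 0 <= output_seq W p y.
Proof. by move=> p0; apply: prodr_ge0 => i _; exact: output_ge0. Qed.

Lemma sum_output_seq p : \sum_x p x = 1 -> \sum_y output_seq W p y = 1.
Proof.
move=> p1; rewrite -(bigA_distr_bigA (fun i => output p (W i))) big1 // => i _.
by rewrite sum_output.
Qed.

Lemma output_seq_tilt_eq0 d psi y :
  output_seq W (unif_dist R A) y = 0 -> output_seq W (tilt d psi) y = 0.
Proof.
move=> /eqP; rewrite prodf_seq_eq0 => /hasP[i _ /= /eqP h].
by rewrite /output_seq (bigD1 i) //= output_tilt_eq0 ?mul0r.
Qed.

Definition total_overlap (d : R) (x x' : A) : R :=
  d ^+ 2 / #|A|%:R * \sum_i overlap (W i) x x'.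

Lemma sum_unif : \sum_x unif_dist R A x = 1.
Proof.
by rewrite sumr_const -[LHS]mulr_natr mulVf // pnatr_eq0 -lt0n.
Qed.

Lemma unif_ge0 x : 0 <= unif_dist R A x.
Proof. by rewrite /unif_dist invr_ge0 ler0n. Qed.

(** The chi-square form is multiplicative over independent players, and each factor [1 + t] is at
    most [expR t]. *)
Lemma sum_output_seq_tilt_chi2_le d psi psi' :
  (forall x, 0 <= tilt d psi x) -> (forall x, 0 <= tilt d psi' x) ->
  \sum_x psi x = 0 -> \sum_x psi' x = 0 ->
  \sum_y output_seq W (tilt d psi) y * output_seq W (tilt d psi') y
    / output_seq W (unif_dist R A) y <=
  expR (\sum_x \sum_x' psi x * psi' x' * total_overlap d x x').
Proof.
move=> p0 p0' s0 s0'.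
under eq_bigr do rewrite /output_seq -big_split -prodf_div /=.
pose F i y := output (tilt d psi) (W i) y * output (tilt d psi') (W i) y
    / output (unif_dist R A) (W i) y.
rewrite -(bigA_distr_bigA F).
have -> : \sum_x \sum_x' psi x * psi' x' * total_overlap d x x' =
    \sum_i \sum_x \sum_x' psi x * psi' x' * (d ^+ 2 / #|A|%:R * overlap (W i) x x').
  rewrite [RHS]exchange_big; apply: eq_bigr => x _.
  rewrite [RHS]exchange_big; apply: eq_bigr => x' _.
  by rewrite /total_overlap !mulr_sumr.
rewrite expR_sum; apply: ler_prod => i _; apply/andP; split.
  apply: sumr_ge0 => y _.
  by rewrite /F !mulr_ge0 ?invr_ge0 ?output_ge0 //; exact: unif_ge0.
by rewrite sum_output_tilt_chi2 //; exact: expR_ge1Dx.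
Qed.

(** Cauchy-Schwarz over the players costs one factor [n]; summing their Frobenius norms gives the
    other factor [n] and [#|Y|]. *)
Lemma total_overlap_frobenius d :
  \sum_x \sum_x' total_overlap d x x' ^+ 2 <=
  d ^+ 4 / #|A|%:R ^+ 2 * (n%:R ^+ 2 * #|Y|%:R).
Proof.
have C x x' : total_overlap d x x' ^+ 2 <=
    d ^+ 4 / #|A|%:R ^+ 2 * (n%:R * \sum_i overlap (W i) x x' ^+ 2).
  have -> : d ^+ 4 / #|A|%:R ^+ 2 = (d ^+ 2 / #|A|%:R) ^+ 2 :> R.
    by rewrite expr_div_n -exprM.
  rewrite exprMn ler_wpM2l ?sqr_ge0 //.
  have := sum_sqr_le_CauchySchwarz (fun=> 1) (fun i => overlap (W i) x x').
  under eq_bigr do rewrite mul1r.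
  by rewrite expr1n sumr_const card_ord.
apply: (le_trans (ler_sum _ (fun x _ => ler_sum _ (fun x' _ => C x x')))).
under eq_bigr do rewrite -!mulr_sumr.
rewrite -!mulr_sumr ler_wpM2l //.
  by rewrite mulr_ge0 ?invr_ge0 ?sqr_ge0 // (exprM d 2 2) sqr_ge0.
rewrite expr2 -mulrA ler_wpM2l ?ler0n //.
under eq_bigr do rewrite exchange_big.
rewrite exchange_big /= mulr_natl -[X in _ *+ X](card_ord n) -sumr_const.
by apply: ler_sum => i _; exact: overlap_frobenius.
Qed.

End players.

End channel.

(** * Testing uniform against the mixture of alternatives, for fixed channels *)

Section indistinguishability.
Variables (R : realType) (A Y I J : finType) (e : I * J -> A) (n : nat).
Variables (W : 'I_n -> A -> Y -> R) (d : R).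
Hypothesis e_inj : injective e.
Hypothesis J_gt0 : (0 < #|J|)%N.
Hypothesis A_gt0 : (0 < #|A|)%N.
Hypothesis hW : forall i, channels (W i).
Hypothesis d01 : 0 <= d <= 1.

Definition alternative (z : {ffun I -> J}) : A -> R := tilt d (perturb R e z).

Lemma alternative_simplex z : prob_simplex (alternative z).
Proof.
have k0 : #|A|%:R != 0 :> R by rewrite pnatr_eq0 -lt0n.
split=> [x|].
  rewrite mulr_ge0 ?invr_ge0 ?ler0n //.
  have := perturb_geN1 R e_inj z x; case/andP: d01 => d0 d1.
  by move=> h; have := ler_wpM2l d0 h; lra.
rewrite -mulr_sumr big_split /= -mulr_sumr sum_perturb mulr0 addr0.
by rewrite sumr_const mulVf.
Qed.

Lemma dTV_alternative_ge z :
  d * (#|I|%:R * (#|J|%:R - 1)) / #|A|%:R <= dTV (alternative z) (unif_dist R A).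
Proof.
rewrite /dTV.
have -> : \sum_a `|alternative z a - unif_dist R A a| =
    d / #|A|%:R * \sum_a `|perturb R e z a|.
  rewrite mulr_sumr; apply: eq_bigr => a _.
  have -> : alternative z a - unif_dist R A a = d / #|A|%:R * perturb R e z a.
    by rewrite /alternative /tilt /unif_dist; ring.
  rewrite normrM ger0_norm // mulr_ge0 ?invr_ge0 ?ler0n //.
  by case/andP: d01.
have c0 : 0 <= d / #|A|%:R.
  by rewrite mulr_ge0 ?invr_ge0 ?ler0n //; case/andP: d01.
by have := ler_wpM2l c0 (sum_norm_perturb_ge R e_inj J_gt0 z); lra.
Qed.

(** The two terms are the probabilities of a right answer under the uniform law and under a random
    alternative. A chi-square distance close to zero keeps their sum well below the [11/6] that a
    test requires. *)
Lemma sum_test_error_le (T : {ffun 'I_n -> Y} -> bool) :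
  64 * #|J|%:R ^+ 4 * (d ^+ 4 / #|A|%:R ^+ 2 * (n%:R ^+ 2 * #|Y|%:R)) <= 1 ->
  \sum_(y | T y) output_seq W (unif_dist R A) y +
    #|{ffun I -> J}|%:R^-1 *
      \sum_z \sum_(y | ~~ T y) output_seq W (alternative z) y <= 4 / 3.
Proof.
move=> hsmall; set N : R := #|{ffun I -> J}|%:R.
have N0 : N != 0.
  by rewrite pnatr_eq0 card_ffun expn_eq0 negb_and -lt0n J_gt0.
have Ngt0 : 0 < N by rewrite lt_neqAle eq_sym N0 ler0n.
pose P := output_seq W (unif_dist R A).
pose Q y := N^-1 * \sum_z output_seq W (alternative z) y.
have P0 y : 0 <= P y by apply: output_seq_ge0 => //; exact: unif_ge0.
have sP : \sum_y P y = 1 by rewrite sum_output_seq // sum_unif.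
have sQ : \sum_y Q y = 1.
  rewrite -mulr_sumr exchange_big /=.
  under eq_bigr do rewrite sum_output_seq ?(alternative_simplex _).2 //.
  by rewrite sumr_const mulVf.
have chi2 : \sum_y Q y ^+ 2 / P y <= expR 16^-1.
  have -> : \sum_y Q y ^+ 2 / P y = N^-1 ^+ 2 * \sum_z \sum_z'
      \sum_y output_seq W (alternative z) y * output_seq W (alternative z') y / P y.
    under [X in _ * X]eq_bigr do rewrite exchange_big.
    rewrite exchange_big mulr_sumr; apply: eq_bigr => y _ /=.
    rewrite /Q exprMn -mulrA; congr (_ * _).
    rewrite expr2 -mulrA mulr_suml; apply: eq_bigr => z _.
    by rewrite mulr_suml mulr_sumr; apply: eq_bigr => z' _; rewrite mulrA.
  apply: (@le_trans _ _ (N^-1 ^+ 2 * (N ^+ 2 * expR 16^-1))); last first.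
    by rewrite mulrA -exprMn mulVf // expr1n mul1r.
  rewrite ler_wpM2l ?sqr_ge0 //.
  apply: le_trans (sum_expR_perturb_bilinear e_inj J_gt0 (M := total_overlap W d) _).
    apply: ler_sum => z _; apply: ler_sum => z' _.
    apply: sum_output_seq_tilt_chi2_le => //; try exact: (alternative_simplex _).1.
    - exact: sum_perturb.
    - exact: sum_perturb.
  apply: le_trans hsmall; by rewrite ler_wpM2l ?total_overlap_frobenius //.
have e16 : expR 16^-1 <= 16 / 15 :> R.
  have := expR_ge1Dx (- 16^-1 : R); rewrite expRN => h.
  have := expR_gt0 (16^-1 : R); move: h; set E := expR _ => h E0.
  have := ler_wpM2r (ltW E0) h; rewrite mulVf ?gt_eqF //; lra.
rewrite exchange_big mulr_sumr /=.
rewrite big_mkcond [X in _ + X]big_mkcond -big_split /=.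
(* [Q - P <= P / 4 + (Q - P) ^ 2 / P] and [0 <= (Q - P) ^ 2 / P] *)
apply: (@le_trans _ _ (\sum_y (9 / 4 * P y - 2 * Q y + Q y ^+ 2 / P y))).
  apply: ler_sum => y _; rewrite -/(Q y) -/(P y).
  have [Py|Py] := eqVneq (P y) 0.
    have Qy : Q y = 0.
      rewrite /Q big1 ?mulr0 // => z _; exact: output_seq_tilt_eq0.
    by rewrite Py Qy expr0n /= mul0r; case: (T y); rewrite /=; lra.
  have Py0 : 0 < P y by rewrite lt_neqAle eq_sym Py P0.
  have E1 : Q y ^+ 2 / P y = (Q y - P y) ^+ 2 / P y + 2 * Q y - P y by field.
  have E2 : (Q y - P y) ^+ 2 / P y =
      (Q y - 3 / 2 * P y) ^+ 2 / P y + Q y - 5 / 4 * P y by field.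
  have : 0 <= (Q y - P y) ^+ 2 / P y by rewrite mulr_ge0 ?sqr_ge0 ?invr_ge0.
  have : 0 <= (Q y - 3 / 2 * P y) ^+ 2 / P y by rewrite mulr_ge0 ?sqr_ge0 ?invr_ge0.
  by case: (T y); rewrite /=; lra.
(* The total is at most [9/4 - 2 + 16/15], which is below [4/3]. *)
clearbody P Q; rewrite big_split sumrB -!mulr_sumr /= sP sQ; lra.
Qed.

End indistinguishability.

(** * From tests to the lower bound *)

Lemma injection_of_card_leq (T U : finType) :
  (#|T| <= #|U|)%N -> exists e : T -> U, injective e.
Proof.
move=> h; exists (fun t => enum_val (widen_ord h (enum_rank t))).
move=> t t' /enum_val_inj /(congr1 val) /= /val_inj; exact: enum_rank_inj.
Qed.

Section lower_bound.
Variables (R : realType) (A Y : finType) (n : nat).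
Variables (pi : public_coin_protocol (@channels R A Y) n) (T : referee pi).

Definition referee_prob_given (p : A -> R) (b : bool) (u : coin pi) : R :=
  \sum_(y : {ffun 'I_n -> Y} | sval T y u == b) output_seq (chan u) p y.

Lemma referee_probE p b : referee_prob T p b =
  (\int[coin_law pi]_(u in [set: coin pi]) (referee_prob_given p b u)%:E)%E.
Proof.
apply: eq_integral => u _; congr EFin; rewrite exchange_big.
by apply: eq_bigr => y _; rewrite sum_joint_pmf.
Qed.

Lemma referee_prob_given_ge0 p b u :
  (forall x, 0 <= p x) -> 0 <= referee_prob_given p b u.
Proof.
move=> p0; apply: sumr_ge0 => y _; apply: output_seq_ge0 => // i.
exact: chan_family.
Qed.

Lemma measurable_referee_prob_given p b :
  measurable_fun [set: coin pi] (referee_prob_given p b).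
Proof.
rewrite /referee_prob_given.
under eq_fun do rewrite big_mkcond /=.
apply: measurable_sum => y; apply: measurable_fun_ifT.
- have -> : (fun u => sval T y u == b) =
      (fun u => if b then sval T y u else ~~ sval T y u).
    by apply/funext => u; case: b; case: (sval T y u).
  by case: b; [|apply: measurable_neg]; exact: (svalP T).
- apply: measurable_prod => i _; apply: measurable_sum => x.
  by apply: measurable_funM; [exact: measurable_cst|exact: chan_measurable].
- exact: measurable_cst.
Qed.

(** The family of alternatives does not depend on the coins. If the inequality failed, the success
    probabilities summed over [z] would be at most [4/3] per alternative for every value of the
    coins, whereas their integral is at least [11/6] for each [z]. *)
Lemma identity_test_card_lt (I J : finType) (d eps : R) :
  identity_test (unif_dist R A) eps T ->
  (0 < #|J|)%N -> (0 < #|A|)%N -> (#|I| * #|J| <= #|A|)%N -> 0 <= d <= 1 ->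
  eps < d * (#|I|%:R * (#|J|%:R - 1)) / #|A|%:R ->
  #|A|%:R ^+ 2 < 64 * #|J|%:R ^+ 4 * d ^+ 4 * n%:R ^+ 2 * #|Y|%:R :> R.
Proof.
move=> [hu hp] J0 A0 IJ d01 heps; rewrite ltNge; apply/negP => hsmall.
have A0' : 0 < #|A|%:R :> R by rewrite ltr0n.
have [|e e_inj] := @injection_of_card_leq (I * J)%type A; first by rewrite card_prod.
pose N := #|{ffun I -> J}|.
have N0 : 0 < N%:R :> R by rewrite ltr0n /N card_ffun expn_gt0 J0.
pose f z u := referee_prob_given (unif_dist R A) true u +
  referee_prob_given (alternative e d z) false u.
have f0 z u : 0 <= f z u.
  rewrite addr_ge0 ?referee_prob_given_ge0 //; first exact: unif_ge0.
  exact: (alternative_simplex e_inj A0 d01 z).1.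
have mf z : measurable_fun [set: coin pi] (fun u => (f z u)%:E).
  by apply/measurable_EFinP/measurable_funD; exact: measurable_referee_prob_given.
have lower z : ((11 / 6)%:E <=
    \int[coin_law pi]_(u in [set: coin pi]) (f z u)%:E)%E.
  have -> : (\int[coin_law pi]_(u in [set: coin pi]) (f z u)%:E =
      referee_prob T (unif_dist R A) true +
      referee_prob T (alternative e d z) false)%E.
    rewrite !referee_probE -ge0_integralD //.
    - by move=> u _; rewrite lee_fin referee_prob_given_ge0 //; exact: unif_ge0.
    - by apply/measurable_EFinP; exact: measurable_referee_prob_given.
    - move=> u _; rewrite lee_fin referee_prob_given_ge0 //.
      exact: (alternative_simplex e_inj A0 d01 z).1.
    - by apply/measurable_EFinP; exact: measurable_referee_prob_given.
  have -> : 11 / 6 = 11 / 12 + 11 / 12 :> R by lra.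
  rewrite EFinD leeD //; first exact: ltW.
  apply/ltW/hp; first exact: alternative_simplex.
  exact: lt_le_trans heps (dTV_alternative_ge e_inj J0 d01 z).
have pointwise u : \sum_z f z u <= N%:R * (4 / 3).
  have := @sum_test_error_le R A Y I J e n (chan u) d e_inj J0 A0
    (fun i => chan_family u i) d01 (fun y => sval T y u) _.
  rewrite -/N => h; rewrite big_split /= sumr_const -[X in X + _]mulr_natl.
  rewrite -[X in _ + X](mulVKf (lt0r_neq0 N0)) -mulrDr ler_pM2l //.
  apply: le_trans (h _).
    apply: lerD; apply: ler_of_eq; first by apply: eq_bigl => y; rewrite eqb_id.
    congr (_ * _).
    by apply: eq_bigr => z _; apply: eq_bigl => y; rewrite eqbF_neg.
  have -> : 64 * #|J|%:R ^+ 4 * (d ^+ 4 / #|A|%:R ^+ 2 * (n%:R ^+ 2 * #|Y|%:R)) =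
      (64 * #|J|%:R ^+ 4 * d ^+ 4 * n%:R ^+ 2 * #|Y|%:R) / #|A|%:R ^+ 2 :> R by ring.
  by rewrite ler_pdivrMr ?mul1r // exprn_gt0.
have : ((N%:R * (11 / 6))%:E <= (N%:R * (4 / 3))%:E :> \bar R)%E.
  apply: (@le_trans _ _
    (\int[coin_law pi]_(u in [set: coin pi]) (\sum_z (f z u)%:E))%E).
    rewrite ge0_integral_sum //; last by move=> z u _; rewrite lee_fin.
    rewrite mulr_natl -sumr_const -sumEFin.
    by apply: lee_sum => z _.
  have <- : (\int[coin_law pi]_(u in [set: coin pi]) (N%:R * (4 / 3))%:E =
      (N%:R * (4 / 3))%:E)%E.
    apply: etrans (integral_cst (coin_law pi) measurableT _) _.
    rewrite -[RHS]mule1; congr (_ * _)%E; exact: probability_setT.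
  apply: ge0_le_integral => //.
  - by move=> u _; rewrite sume_ge0 // => z _; rewrite lee_fin.
  - by apply: emeasurable_sum.
  - by move=> u _; rewrite sumEFin lee_fin.
rewrite lee_fin ler_pM2l //; lra.
Qed.

End lower_bound.

Unset Implicit Arguments.

(* The bound degenerates as eps -> 1: for eps >= 1 - k^-1 no distribution is at
   distance > eps from uniform, so one player suffices whatever k is.  Hence
   eps ranges over ]0, eps0], where eps0 < 1 is arbitrary, and c depends on eps0
   only. *)
Theorem theorem5p3 (R : realType) (eps0 : R) (heps0 : eps0 < 1) :
  exists2 c : R, 0 < c &
    forall (k ell : nat) (eps : R),
      (2 <= k)%N -> ~~ odd k -> (1 <= ell)%N -> 0 < eps -> eps <= eps0 ->
      ((c * (k%:R / (2 `^ (ell%:R / 2) * eps ^+ 2)))%:E <=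
        uniformity_sample_complexity eps (bit_channels R k ell))%E.
Proof.
(* The block length is chosen with [1 - 2 / m > eps0]: long blocks reach distance [1 - 1 / m], and
   an incomplete last block may cost another [1 / m]. *)
pose m := (Num.truncn (2 / (1 - eps0))).+2.
have m2 : 2 <= m%:R :> R by rewrite ler_nat.
have hm : 2 < m%:R * (1 - eps0).
  have h0 : 0 < 1 - eps0 by lra.
  rewrite -ltr_pdivrMr //; apply: lt_le_trans (truncnS_gt _) _.
  by rewrite ler_nat.
(* The number [288] is the square root of [64 * 2^4 * 3^4], from blocks of two symbols with
   [d = 3 eps]; the factor [m^2] serves larger [eps]. *)
exists (288 * m%:R ^+ 2)^-1.
  by rewrite invr_gt0 mulr_gt0 // exprn_gt0 //; lra.
move=> k ell eps k2 k_even ell1 eps_gt0 eps_le.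
apply: le_ereal_inf_tmp => _ [n /= [n_gt0 [pi [T hT]]] <-]; rewrite lee_fin.
set s := 2 `^ (ell%:R / 2).
have s2 : s ^+ 2 = 2 ^+ ell.
  by rewrite -powR_mulrn ?powR_ge0 // -powRrM mulfVK // powR_mulrn.
have s_gt0 : 0 < s by exact: powR_gt0.
have s1 : 1 <= s.
  rewrite -(@ler_pXn2r _ 2) ?nnegrE ?(ltW s_gt0) // expr1n s2.
  by rewrite exprn_ege1 // ler1n.
have kR : 2 <= k%:R :> R by rewrite ler_nat.
have n1 : 1 <= n%:R :> R by rewrite ler1n.
have sn1 : 1 <= n%:R * s by rewrite -[leLHS]mulr1 ler_pM.
have cardY : #|{: ell.-tuple bool}|%:R = s ^+ 2 :> R.
  by rewrite card_tuple card_bool natrX s2.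
(* As many disjoint blocks of [b] symbols as fit, after taking square roots of both sides. *)
have key (b : nat) (d C : R) : 0 <= C -> (0 < b)%N -> 0 <= d <= 1 ->
    eps < d * ((k %/ b)%N%:R * (b%:R - 1)) / k%:R ->
    64 * b%:R ^+ 4 * d ^+ 4 = C ^+ 2 ->
    k%:R < C * (n%:R * s).
  move=> C0 b0 d01 hd hC.
  have := identity_test_card_lt (I := 'I_(k %/ b)) (J := 'I_b) hT _ _ _ d01.
  rewrite !card_ord cardY hC => /(_ b0 (ltnW k2) (leq_trunc_div _ _) hd).
  rewrite -mulrA -!exprMn.
  by rewrite ltr_pXn2r // nnegrE ?ler0n // mulr_ge0 //; lra.
have suff_bound : k%:R <= 288 * m%:R ^+ 2 * (eps ^+ 2 * (n%:R * s)) ->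
    (288 * m%:R ^+ 2)^-1 * (k%:R / (s * eps ^+ 2)) <= n%:R.
  have c0 : 0 < 288 * m%:R ^+ 2 :> R by rewrite mulr_gt0 // exprn_gt0; lra.
  move=> h; rewrite ler_pdivrMl // ler_pdivrMr ?mulr_gt0 ?exprn_gt0 //.
  by lra.
apply: suff_bound.
have m4 : 4 <= m%:R ^+ 2 :> R by nra.
(* For [eps <= 1/4], pairs cover all symbols because [k] is even, and [d = 3 eps <= 1] gives
   distance [3/2 eps > eps]. *)
have [eps4|eps4] := leP eps 4^-1.
  have := key 2 (3 * eps) (288 * eps ^+ 2).
  rewrite divn2 => /(_ _ isT).
  have k2E : k%:R = 2 * (k./2)%:R :> R.
    by rewrite -{1}(odd_double_half k) (negPf k_even) add0n -muln2 natrM mulrC.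
  have h1 : eps < 3 * eps * (k./2%:R * (2 - 1)) / k%:R.
    have -> : 3 * eps * (k./2%:R * (2 - 1)) / k%:R = 3 / 2 * eps.
      by rewrite k2E; field; have := kR; rewrite k2E; lra.
    lra.
  have h2 : 64 * 2 ^+ 4 * (3 * eps) ^+ 4 = (288 * eps ^+ 2) ^+ 2 by ring.
  have h3 : 0 <= 288 * eps ^+ 2 by nra.
  have h4 : 0 <= 3 * eps <= 1 by apply/andP; split; lra.
  move=> /(_ h3 h4 h1 h2) h.
  have e2 : 0 <= eps ^+ 2 * (n%:R * s) by rewrite mulr_ge0 ?sqr_ge0 //; lra.
  have := ler_wpM2r e2 m4; lra.
(* From here [eps] is bounded below, so a bound without [eps] suffices, at the price of a factor
   [16]. *)
have e2 : 16^-1 <= eps ^+ 2 by nra.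
have e2n : 16^-1 * (n%:R * s) <= eps ^+ 2 * (n%:R * s) by rewrite ler_wpM2r //; lra.
suff : k%:R <= 8 * m%:R ^+ 2 * (n%:R * s).
  have : 0 <= m%:R ^+ 2 :> R by lra.
  by move=> h; have := ler_wpM2l h e2n; lra.
have [km|km] := leqP k (m ^ 2)%N.
  have : k%:R <= m%:R ^+ 2 :> R by rewrite -natrX ler_nat.
  have : 0 <= m%:R ^+ 2 :> R by lra.
  by move=> h; have := ler_wpM2l h sn1; lra.
(* With [d = 1] and [k > m^2], fewer than [m < k / m] symbols are left out, so the distance exceeds
   [(1 - 1 / m)^2 > 1 - 2 / m > eps0]. *)
apply/ltW/(key m 1) => //.
- by rewrite ler01 lexx.
- rewrite mul1r; apply: le_lt_trans eps_le _.
  rewrite ltr_pdivlMr; last lra.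
  have hk : k%:R < (k %/ m)%N%:R * m%:R + m%:R :> R.
    rewrite -natrM -natrD ltr_nat [ltnLHS](divn_eq k m) ltn_add2l ltn_mod //.
  have km' : m%:R ^+ 2 < k%:R :> R by rewrite -natrX ltr_nat.
  set q : R := (k %/ m)%N%:R in hk *.
  have m0 : 0 < m%:R :> R by lra.
  rewrite -(ltr_pM2l m0).
  have h1 : (k%:R - m%:R) * (m%:R - 1) <= m%:R * (q * (m%:R - 1)).
    by rewrite mulrA ler_wpM2r; lra.
  apply: lt_le_trans h1.
  have := ltr_pM2r (_ : 0 < k%:R :> R) 2 (m%:R * (1 - eps0)).
  rewrite hm => /(_ _); lra.
- ring.
Qed.
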